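(* Let $n\ge 1$. There exist a curvature-like function $s\colon S^1\to(\mathbb{R}_+)^{n-1}\times\mathbb{R}$ and a real number $\varepsilon_0>0$ such that for every $\varepsilon$ with $0<\varepsilon<\varepsilon_0$ there is no closed Frenet curve $\alpha\colon S^1\to\mathbb{H}^{n+1}$ in the hyperbolic space $\mathbb{H}^{n+1}$ satisfying $|s(t)-j_\alpha(t)|<\varepsilon$ for all $t\in S^1$.
   Context: $\mathbb{R}_+$ denotes the set of strictly positive real numbers. $\mathbb{H}^{n+1}$ is the oriented hyperbolic $(n+1)$-space (complete, simply connected, constant sectional curvature $-1$). Frenet curves and curvatures in $\mathbb{H}^{n+1}$ are defined as in Euclidean space, with ordinary derivatives of vector fields along the curve replaced by the covariant derivative $\nabla_t$ along the curve. Explicitly, a closed Frenet curve is a $C^{n+1}$-differentiable map $\alpha\colon S^1\to\mathbb{H}^{n+1}$ such that $\alpha',\nabla_t\alpha',\dots,\nabla_t^{\,n-1}\alpha'$ are linearly independent at each $t\in S^1$. Applying Gram-Schmidt to these vectors gives orthonormal vectors $e_1,\dots,e_n$ along $\alpha$, completed by a unique unit vector $e_{n+1}$ to a positively oriented orthonormal frame. The curvatures $\kappa_1^\alpha,\dots,\kappa_n^\alpha$ are defined by $$\frac{1}{|\alpha'|}\nabla_te_1=\kappa_1^\alpha e_2,\qquad \frac{1}{|\alpha'|}\nabla_te_{i+1}=-\kappa_i^\alpha e_i+\kappa_{i+1}^\alpha e_{i+2}\ (i=1,\dots,n-1),\qquad \frac{1}{|\alpha'|}\nabla_te_{n+1}=-\kappa_n^\alpha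 e_n,$$ and $j_\alpha(t)=(\kappa_1^\alpha(t),\dots,\kappa_n^\alpha(t))$. A curvature-like function is a continuous map $S^1\to(\mathbb{R}_+)^{n-1}\times\mathbb{R}$; $|s(t)-j_\alpha(t)|$ is the Euclidean norm in $\mathbb{R}^n$. *)

(* Defs.v *)
From mathcomp Require Import all_boot all_order all_algebra.
From mathcomp Require Import all_classical all_reals all_analysis.

Set Implicit Arguments.
Unset Strict Implicit.
Unset Printing Implicit Defensive.

Import Order.TTheory GRing.Theory Num.Theory.
Import numFieldNormedType.Exports.

Local Open Scope classical_set_scope.
Local Open Scope ring_scope.

(* Hyperbolic space is the upper sheet of the hyperboloid in Minkowski space,
   with the Riemannian metric induced by the Lorentz form. The circle is
   R / (2 pi Z): a map on S^1 is a (2 pi)-periodic function on R.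
   All families are indexed from 0: [e i] is the textbook e_{i+1}, and
   [j t 0 i] is the textbook kappa_{i+1}(t). *)

Section Minkowski.
Variables (R : realType) (m : nat).
Implicit Types u v : 'rV[R]_m.+1.

Definition lorentz u v : R :=
  - (u 0 0 * v 0 0) + \sum_(i < m) u 0 (lift ord0 i) * v 0 (lift ord0 i).

(* The restriction of the Lorentz form to a tangent space of the hyperboloid
   is positive definite, so this is the Riemannian norm of a tangent vector. *)
Definition lorentz_norm u : R := Num.sqrt (lorentz u u).

Definition hyperbolic_space : set 'rV[R]_m.+1 :=
  [set x | lorentz x x = -1 /\ 0 < x 0 0].

(* The Levi-Civita connection of the hyperboloid: the tangential part at
   [alpha t] of the ordinary derivative, i.e. its Lorentz-orthogonal projection
   along the (timelike, unit) normal vector [alpha t]. *)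
Definition covariant_derivative (alpha V : R -> 'rV[R]_m.+1) :
    R -> 'rV[R]_m.+1 :=
  fun t => derive1 V t + lorentz (derive1 V t) (alpha t) *: alpha t.

(* [:: v_0, .., v_(k-1)] orthonormalized for the Lorentz form. *)
Fixpoint gram_schmidt (v : nat -> 'rV[R]_m.+1) (k : nat) : seq 'rV[R]_m.+1 :=
  if k is k'.+1 then
    let es := gram_schmidt v k' in
    let w := v k' - \sum_(e <- es) lorentz (v k') e *: e in
    rcons es ((lorentz_norm w)^-1 *: w)
  else [::].

End Minkowski.

Section FrenetCurves.
Variables (R : realType) (n : nat).
Implicit Types (alpha : R -> 'rV[R]_n.+2) (e : nat -> R -> 'rV[R]_n.+2).
Implicit Types (s j : R -> 'rV[R]_n).

Definition Ck (k m : nat) (f : R -> 'rV[R]_m) : Prop :=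
  (forall (i : nat) (t : R), (i < k)%N -> derivable (derive1n i f) t 1) /\
  continuous (derive1n k f).

Definition covariant_jet alpha (i : nat) : R -> 'rV[R]_n.+2 :=
  iter i (covariant_derivative alpha) (derive1 alpha).

Definition closed_frenet_curve alpha : Prop :=
  [/\ periodic alpha (pi *+ 2),
      forall t, hyperbolic_space (alpha t),
      Ck n.+1 alpha
    & forall t, row_free (\matrix_(i < n) covariant_jet alpha i t)].

(* Only [e 0, .., e n] are relevant. A basis (v_0, .., v_n) of the tangent space
   at x is positively oriented when det (x, v_0, .., v_n) > 0. *)
Definition frenet_frame alpha e : Prop :=
  forall t : R,
  [/\ forall i, (i < n)%N ->
        e i t = (gram_schmidt (fun k => covariant_jet alpha k t) n)`_i,
      lorentz (e n t) (alpha t) = 0,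
      lorentz (e n t) (e n t) = 1,
      forall i, (i < n)%N -> lorentz (e n t) (e i t) = 0
    & 0 < \det (\matrix_(i < n.+2)
                  if val i is i'.+1 then e i' t else alpha t)].

Definition frenet_equations alpha e j : Prop :=
  forall t : R,
  let D := fun i => (lorentz_norm (derive1 alpha t))^-1 *:
                    covariant_derivative alpha (e i) t in
  [/\ forall i : 'I_n, i = 0%N :> nat -> D 0%N = j t 0 i *: e 1%N t,
      forall i k : 'I_n, k = i.+1 :> nat ->
        D i.+1 = - j t 0 i *: e i t + j t 0 k *: e i.+2 t
    & forall i : 'I_n, i.+1 = n -> D n = - j t 0 i *: e i t].

(* [j] is the curvature map j_alpha of [alpha]. *)
Definition frenet_curvatures alpha j : Prop :=
  exists e, frenet_frame alpha e /\ frenet_equations alpha e j.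

Definition curvature_like s : Prop :=
  [/\ periodic s (pi *+ 2),
      continuous s
    & forall (t : R) (i : 'I_n), (i.+1 < n)%N -> 0 < s t 0 i].

(* The library norm on row vectors is the sup norm. *)
Definition euclidean_norm (x : 'rV[R]_n) : R :=
  Num.sqrt (\sum_(i < n) x 0 i ^+ 2).

End FrenetCurves.

(* Main.v *)
Require Import Defs.
From mathcomp Require Import all_boot all_order all_algebra.
From mathcomp Require Import all_classical all_reals all_analysis.
From mathcomp Require Import ring lra.

Set Implicit Arguments.
Unset Strict Implicit.
Unset Printing Implicit Defensive.

Import Order.TTheory GRing.Theory Num.Theory.
Import numFieldNormedType.Exports.

Local Open Scope ring_scope.

(** A closed curve in hyperbolic space must somewhere bend at least as much as
    a horosphere: it cannot have first curvature of absolute value below 1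
    everywhere. So the constant curvature-like function 1/2, with tolerance
    1/2, is not approximated by any closed Frenet curve: its first curvature
    would lie between 0 and 1.

    To see the bound on the curvature, look at a point of the closed curve
    [alpha] that is farthest from the point (1, 0, .., 0) of the hyperboloid,
    that is, where the coordinate 0 of [alpha], called x0, is maximal. Let [c]
    be the speed. The first Frenet equation, read in the ambient Minkowski
    space, is
      e_1' = c (alpha + kappa_1 e_2),
    because the normal component of [e_1'] is prescribed by
    <e_1', alpha> = - <e_1, alpha'> = - c. The coordinate 0 of [e_2] is smaller
    in absolute value than that of [alpha], as [e_2] is tangent to the
    hyperboloid at [alpha] and has norm at most 1 ([tangent_sqr_time_coord]).
    Hence |kappa_1| < 1 makes the coordinate 0 of [e_1] have positive derivative
    at the farthest point. It vanishes there and is x0' / c, so x0 increases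
    just after its maximum ([exceeds_after_critical_point]), a contradiction. *)

(** * Real functions of one variable *)

Lemma periodic_attains_max (R : realType) (f : R -> R) (T : R) :
  0 < T -> periodic f T -> continuous f -> exists c, forall t, f t <= f c.
Proof.
move=> T0 fT fc.
have [|c _ fmax] := @EVT_max R f 0 T (ltW T0); first exact: continuous_subspaceT.
have fTz (k : int) t : f (t + k%:~R * T) = f t.
  case: k => k; first by rewrite -[in RHS](periodicn fT k) -mulr_natl.
  rewrite -(periodicn fT k.+1 (t + _)) NegzE -mulr_natl mulrNz mulNr.
  by rewrite addrNK.
exists c => t.
(* Translate [t] into the fundamental domain [0, T]. *)
rewrite -(fTz (- Num.floor (t / T))) fmax// in_itv/=.
have := floor_itv (t / T).
rewrite rmorphN/= mulNr intrD => /andP[lo hi].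
rewrite ler_pdivlMr// in lo; rewrite ltr_pdivrMr// mulrDl mul1r in hi.
by apply/andP; split; lra.
Qed.

(** A second derivative test that differentiates [f' / c] instead of [f']: just
    after [t0] the function [u], hence [f'], is positive, so [f] increases
    there. *)
Lemma exceeds_after_critical_point (R : realType) (f u c : R -> R) (t0 : R) :
  (forall t : R, is_derive t 1 f (c t * u t)) -> (forall t, 0 < c t) ->
  derivable u t0 1 -> u t0 = 0 -> 0 < derive1 u t0 ->
  exists t, f t0 < f t.
Proof.
move=> df c0 du ut0 u'0.
have [d d0 upos] : exists2 d, 0 < d & forall t, t0 < t < t0 + d -> 0 < u t.
  rewrite derive1E in u'0.
  have /cvgr_gt /(_ _ u'0) [d /= d0 dP] := du.
  exists d => // t /andP[t0t ttd].
  have h0 : 0 < t - t0 by rewrite subr_gt0.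
  have := dP (t - t0); rewrite /= sub0r normrN gtr0_norm// ltrBlDl => /(_ ttd).
  rewrite ut0 subr0 [_%:A]mulr1 subrK gt_eqF// => /(_ isT).
  by rewrite /GRing.scale/= pmulr_rgt0// invr_gt0.
have t0d : t0 < t0 + d / 2 by lra.
have [|z] := @MVT R f (fun t => c t * u t) t0 (t0 + d / 2) t0d.
  by apply: derivable_within_continuous => x _; exact: ex_derive.
rewrite in_itv/= => /andP[t0z zd] E; exists (t0 + d / 2).
rewrite -subr_gt0 E !mulr_gt0 ?c0 ?upos//; lra.
Qed.

Lemma is_derive_coord (R : realType) (m n : nat) (M : R -> 'M[R]_(m, n))
    (t : R) (i : 'I_m) (j : 'I_n) :
  derivable M t 1 -> is_derive t 1 (fun s => M s i j) (derive1 M t i j).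
Proof.
move=> dM; apply: DeriveDef; first by have [+ _] := derivable_mxP M t 1; apply.
by rewrite derive1E derive_mx// mxE.
Qed.

(** * The Lorentz form *)

Section Lorentz.
Variables (R : realType) (m : nat).
Implicit Types u v w x : 'rV[R]_m.+1.

Lemma lorentzC u v : lorentz u v = lorentz v u.
Proof.
by rewrite /lorentz mulrC; congr (_ + _); apply: eq_bigr => i _; rewrite mulrC.
Qed.

Lemma lorentzDl u v w : lorentz (u + v) w = lorentz u w + lorentz v w.
Proof.
rewrite /lorentz !mxE mulrDl opprD addrACA -big_split/=.
by congr (_ + _); apply: eq_bigr => i _; rewrite !mxE mulrDl.
Qed.

Lemma lorentzZl a u v : lorentz (a *: u) v = a * lorentz u v.
Proof.
rewrite /lorentz !mxE mulrDr mulrN mulrA mulr_sumr.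
by congr (_ + _); apply: eq_bigr => i _; rewrite !mxE mulrA.
Qed.

Lemma lorentzZr a u v : lorentz u (a *: v) = a * lorentz u v.
Proof. by rewrite lorentzC lorentzZl lorentzC. Qed.

Lemma lorentz0l v : lorentz 0 v = 0.
Proof. by rewrite -(scale0r 0) lorentzZl mul0r. Qed.

Lemma lorentz_suml (s : seq 'rV[R]_m.+1) (a : 'rV[R]_m.+1 -> R) v :
  (forall e, e \in s -> lorentz e v = 0) ->
  lorentz (\sum_(e <- s) a e *: e) v = 0.
Proof.
move=> sv; rewrite big_seq; elim/big_ind: _ => [|x y x0 y0|e /sv ev].
- exact: lorentz0l.
- by rewrite lorentzDl x0 y0 addr0.
- by rewrite lorentzZl ev mulr0.
Qed.

Lemma sqr_sum_mul_le (I : finType) (a b : I -> R) :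
  (\sum_i a i * b i) ^+ 2 <= (\sum_i a i * a i) * (\sum_i b i * b i).
Proof.
set C := \sum_i _; set A := \sum_i a i * a i; set B := \sum_i b i * b i.
have B0 : 0 <= B by apply: sumr_ge0 => i _; rewrite -expr2 sqr_ge0.
have [B_0|Bn0] := eqVneq B 0.
  suff -> : C = 0 by rewrite B_0 expr0n mulr0.
  apply: big1 => i _.
  have /eqP : b i * b i = 0.
    by apply: (psumr_eq0P _ B_0) => // k _; rewrite -expr2 sqr_ge0.
  by rewrite mulf_eq0 orbb => /eqP ->; rewrite mulr0.
suff : 0 <= B * (A * B - C ^+ 2) by rewrite pmulr_rge0 ?lt0r ?Bn0// subr_ge0.
(* The Lagrange identity: B times the defect is a sum of squares. *)
suff -> : B * (A * B - C ^+ 2) = \sum_i (B * a i - C * b i) ^+ 2.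
  by apply: sumr_ge0 => i _; rewrite sqr_ge0.
under eq_bigr => i _.
  rewrite (_ : _ ^+ 2 = B ^+ 2 * (a i * a i) - (2 * B * C) * (a i * b i)
                        + C ^+ 2 * (b i * b i)); last by ring.
  over.
by rewrite big_split sumrB/= -!mulr_sumr -/A -/B -/C; ring.
Qed.

(** Splitting off the coordinate 0, this is the Cauchy-Schwarz inequality for
    the spatial parts of [v] and [x]. *)
Lemma tangent_sqr_time_coord v x : lorentz x x = -1 -> lorentz v x = 0 ->
  v 0 0 ^+ 2 <= lorentz v v * (x 0 0 ^+ 2 - 1).
Proof.
rewrite /lorentz.
have := sqr_sum_mul_le (fun i => v 0 (lift ord0 i)) (fun i => x 0 (lift ord0 i)).
set A := \sum_i x _ _ * x _ _; set B := \sum_i v _ _ * v _ _.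
set C := \sum_i _ => CAB xx vx.
have -> : x 0 0 ^+ 2 - 1 = A by rewrite expr2; lra.
have CE : C = v 0 0 * x 0 0 by lra.
have AE : A = x 0 0 * x 0 0 - 1 by lra.
move: CAB; rewrite CE AE; nra.
Qed.

Lemma hyperbolic_space_time_coord_ge1 x : hyperbolic_space x -> 1 <= x 0 0 ^+ 2.
Proof.
case=> + _; rewrite /lorentz; set A := \sum_i _ => xx.
have A0 : 0 <= A by apply: sumr_ge0 => i _; rewrite -expr2 sqr_ge0.
by rewrite expr2; lra.
Qed.

(** By [tangent_sqr_time_coord], a tangent vector with [lorentz v v <= 0] has
    coordinate 0 equal to 0; the form then reduces to the sum of the squares of
    the other coordinates, which must all vanish. *)
Lemma lorentz_tangent_gt0 v x : hyperbolic_space x -> lorentz v x = 0 ->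
  v != 0 -> 0 < lorentz v v.
Proof.
move=> Hx vx; apply: contra_neqT; rewrite -leNgt => vv.
have x1 := hyperbolic_space_time_coord_ge1 Hx.
have v0 : v 0 0 = 0.
  apply/eqP; rewrite -sqrf_eq0 eq_le sqr_ge0 andbT.
  apply: le_trans (tangent_sqr_time_coord Hx.1 vx) _.
  by rewrite mulr_le0_ge0// subr_ge0.
move: vv; rewrite /lorentz v0 mul0r oppr0 add0r => vv.
apply/rowP => i; rewrite mxE; case: (unliftP ord0 i) => [k|] -> //.
have sq0 (j : 'I_m) : true -> 0 <= v 0 (lift ord0 j) * v 0 (lift ord0 j).
  by rewrite -expr2 sqr_ge0.
have : \sum_(j < m) v 0 (lift ord0 j) * v 0 (lift ord0 j) = 0.
  by apply/eqP; rewrite eq_le vv sumr_ge0.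
by move/(psumr_eq0P sq0)/(_ k isT)/eqP; rewrite mulf_eq0 orbb => /eqP.
Qed.

(** The factor 0 ^-1 = 0 makes the normalization of a vector that is not
    spacelike the zero vector. *)
Lemma lorentz_normalize_le1 w :
  lorentz ((lorentz_norm w)^-1 *: w) ((lorentz_norm w)^-1 *: w) <= 1.
Proof.
rewrite lorentzZl lorentzZr mulrA -expr2 exprVn /lorentz_norm.
have [ww|ww] := lerP (lorentz w w) 0.
  by rewrite ler0_sqrtr// expr0n invr0 mul0r ler01.
by rewrite (sqr_sqrtr (ltW ww)) mulVf ?gt_eqF.
Qed.

Lemma size_gram_schmidt (v : nat -> 'rV[R]_m.+1) k :
  size (gram_schmidt v k) = k.
Proof. by elim: k => //= k IH; rewrite size_rcons IH. Qed.

Lemma nth_gram_schmidt0 (v : nat -> 'rV[R]_m.+1) k : (0 < k)%N ->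
  (gram_schmidt v k)`_0 = (lorentz_norm (v 0%N))^-1 *: v 0%N.
Proof.
case: k => // k _; elim: k => [|k IH]; first by rewrite /= big_nil subr0.
have [w ->] : exists w, gram_schmidt v k.+2 = rcons (gram_schmidt v k.+1) w.
  by eexists.
by rewrite nth_rcons size_gram_schmidt.
Qed.

Lemma gram_schmidt_orthogonal (v : nat -> 'rV[R]_m.+1) k x e :
  (forall i, (i < k)%N -> lorentz (v i) x = 0) ->
  e \in gram_schmidt v k -> lorentz e x = 0 /\ lorentz e e <= 1.
Proof.
elim: k e => //= k IH e vx; rewrite mem_rcons inE => /predU1P[->|]; last first.
  by apply: IH => i ik; apply: vx; exact: ltnW.
split; last exact: lorentz_normalize_le1.
rewrite lorentzZl lorentzDl vx// add0r -scaleN1r lorentzZl lorentz_suml ?mulr0//.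
by move=> f /IH[]// i ik; apply: vx; exact: ltnW.
Qed.

Lemma is_derive_lorentz (u v : R -> 'rV[R]_m.+1) t :
  derivable u t 1 -> derivable v t 1 ->
  is_derive t 1 (fun s => lorentz (u s) (v s))
    (lorentz (derive1 u t) (v t) + lorentz (u t) (derive1 v t)).
Proof.
move=> du dv.
have D (i j : 'I_m.+1) : is_derive t 1 (fun s => u s 0 i * v s 0 j)
    (derive1 u t 0 i * v t 0 j + u t 0 i * derive1 v t 0 j).
  have := is_deriveM (is_derive_coord 0 i du) (is_derive_coord 0 j dv).
  by move/is_derive_eq; apply; rewrite /GRing.scale/= addrC mulrC.
have S := is_derive_sum (fun i => D (lift ord0 i) (lift ord0 i)).
have := is_deriveD (is_deriveN (D 0 0)) S.
rewrite (_ : _ + _ = fun s => lorentz (u s) (v s)); last first.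
  by apply/funext => s; rewrite /lorentz fctE /= fct_sumE.
move/is_derive_eq; apply.
by rewrite /lorentz big_split/= addrACA opprD.
Qed.

Lemma lorentz_covariant_derivative (alpha V : R -> 'rV[R]_m.+1) t :
  hyperbolic_space (alpha t) ->
  lorentz (covariant_derivative alpha V t) (alpha t) = 0.
Proof.
by case=> aa _; rewrite lorentzDl lorentzZl aa mulrN1 subrr.
Qed.

End Lorentz.

(** * Curves in hyperbolic space *)

Section Curves.
Variables (R : realType) (n : nat).
Implicit Types (alpha : R -> 'rV[R]_n.+2) (e : nat -> R -> 'rV[R]_n.+2).

Lemma lorentz_velocity alpha t : (forall t, hyperbolic_space (alpha t)) ->
  derivable alpha t 1 -> lorentz (derive1 alpha t) (alpha t) = 0.
Proof.
move=> Ha da; have := is_derive_lorentz da da.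
rewrite (_ : (fun s => _) = cst (-1)); last by apply/funext => s; case: (Ha s).
case=> _; rewrite derive_cst.
by rewrite [X in _ + X]lorentzC => /esym/eqP; rewrite -mulr2n mulrn_eq0 => /eqP.
Qed.

(** For n = 1, [e 1] is the vector that completes the frame; for n > 1 it comes
    from the Gram-Schmidt process applied to tangent vectors, which by
    [lorentz_normalize_le1] outputs vectors of norm 0 or 1. *)
Lemma frenet_second_vector alpha e t : (0 < n)%N ->
  (forall t, hyperbolic_space (alpha t)) -> derivable alpha t 1 ->
  frenet_frame alpha e ->
  lorentz (e 1%N t) (alpha t) = 0 /\ lorentz (e 1%N t) (e 1%N t) <= 1.
Proof.
move=> n0 Ha da /(_ t)[eGS ent enn _ _].
have [n1|n_neq1] := eqVneq n 1%N.
  by rewrite (_ : e 1%N t = e n t) ?ent ?enn//; congr (e _ t).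
have n1 : (1 < n)%N by rewrite ltn_neqAle eq_sym n_neq1.
rewrite eGS//; apply: (@gram_schmidt_orthogonal _ _ (covariant_jet alpha ^~ t) n).
  case=> [|i] _; first exact: lorentz_velocity.
  exact: lorentz_covariant_derivative.
by apply: mem_nth; rewrite size_gram_schmidt.
Qed.

Lemma euclidean_norm_coord_le (x : 'rV[R]_n) i : `|x 0 i| <= euclidean_norm x.
Proof.
rewrite /euclidean_norm -sqrtr_sqr ler_wsqrtr// (bigD1 i)//= lerDl.
by apply: sumr_ge0 => k _; exact: sqr_ge0.
Qed.

(** The maximum principle for the height [alpha t 0 0]. This coordinate is the
    hyperbolic cosine of the distance to (1, 0, .., 0), and at its maximum [t0]
    the derivative of the height of [e_1] is
    c (height of alpha + kappa_1 * height of e_2) > 0. *)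
Lemma closed_curve_first_curvature_ge1 alpha j (i0 : 'I_n) :
  i0 = 0%N :> nat -> closed_frenet_curve alpha -> frenet_curvatures alpha j ->
  ~ forall t, `|j t 0 i0| < 1.
Proof.
move=> i00 [aT Ha [da _] fr] [e [fe feq]] j1.
have n0 : (0 < n)%N by case: (n) i0 {i00 j1} => [[]|].
have da1 t : derivable alpha t 1 by exact: (da 0%N t).
have da2 t : derivable (derive1 alpha) t 1 by exact: (da 1%N t).
have tang t : lorentz (derive1 alpha t) (alpha t) = 0 by exact: lorentz_velocity.
have q0 t : 0 < lorentz (derive1 alpha t) (derive1 alpha t).
  apply: (lorentz_tangent_gt0 (Ha t) (tang t)).
  (* The velocity is the row [i0] of the jet matrix, whose rows are free. *)
  have := fr t; apply: contraTneq => a'0.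
  apply/negP => /row_freeP[B /matrixP/(_ i0 i0)/eqP].
  rewrite !mxE eqxx big1 ?(eq_sym _ 1) ?oner_eq0// => k _.
  by rewrite mxE i00 /covariant_jet/= a'0 mxE mul0r.
pose c t := lorentz_norm (derive1 alpha t).
have c0 t : 0 < c t by rewrite sqrtr_gt0.
have cc t : c t * c t = lorentz (derive1 alpha t) (derive1 alpha t).
  by rewrite -expr2 sqr_sqrtr// ltW.
have e0E t : e 0%N t = (c t)^-1 *: derive1 alpha t.
  by have [/(_ _ n0)-> _ _ _ _] := fe t; rewrite nth_gram_schmidt0.
have e0a t : lorentz (e 0%N t) (alpha t) = 0 by rewrite e0E lorentzZl tang mulr0.
have dc t : derivable (fun s => (c s)^-1) t 1.
  apply: derivableV; first exact: lt0r_neq0.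
  have dq := is_derive_lorentz (da2 t) (da2 t).
  have ds := is_derive1_sqrt (q0 t).
  apply/derivable1_diffP/(differentiable_comp (g := Num.sqrt)).
    by apply/derivable1_diffP; exact: (@ex_derive _ _ _ _ _ _ _ dq).
  by apply/derivable1_diffP; exact: (@ex_derive _ _ _ _ _ _ _ ds).
have de t : derivable (e 0%N) t 1.
  rewrite (_ : e 0%N = fun t => (c t)^-1 *: derive1 alpha t); last exact/funext.
  apply/derivable_mxP => i k.
  rewrite (_ : (fun x => _) = (fun x => (c x)^-1) * (fun x => derive1 alpha x i k)).
    apply: derivableM => //.
    exact: (@ex_derive _ _ _ _ _ _ _ (is_derive_coord i k (da2 t))).
  by apply/funext => x; rewrite mxE.
have df t := is_derive_coord 0 0 (da1 t).
have [|||t0 t0max] := @periodic_attains_max R (fun t => alpha t 0 0) (pi *+ 2).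
- by rewrite mulrn_wgt0 ?pi_gt0.
- by move=> t; rewrite aT.
- move=> t; apply/differentiable_continuous/derivable1_diffP.
  exact: (@ex_derive _ _ _ _ _ _ _ (df t)).
have f'0 : derive1 alpha t0 0 0 = 0.
  have : is_derive t0 1 (fun t => alpha t 0 0) 0.
    apply: (@derive1_at_max _ _ (t0 - 1) (t0 + 1)).
    - by lra.
    - by move=> t _; exact: (@ex_derive _ _ _ _ _ _ _ (df t)).
    - by rewrite in_itv/=; apply/andP; split; lra.
    - by move=> t _; exact: t0max.
  by case=> _; rewrite (derive_val (is_derive := df t0)).
have [|||||t] := @exceeds_after_critical_point R (fun t => alpha t 0 0)
    (fun t => e 0%N t 0 0) c t0; last 1 first.
- by rewrite ltNge t0max.
- move=> t; move/is_derive_eq: (df t); apply.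
  by rewrite e0E mxE mulVKf// lt0r_neq0.
- by [].
- exact: (@ex_derive _ _ _ _ _ _ _ (is_derive_coord 0 0 (de t0))).
- by rewrite e0E mxE f'0 mulr0.
have de0 := is_derive_coord 0 0 (de t0).
rewrite derive1E (derive_val (is_derive := de0)).
(* The normal component of [e_1'], from <e_1, alpha> = 0. *)
have normal : lorentz (derive1 (e 0%N) t0) (alpha t0) = - c t0.
  have := is_derive_lorentz (de t0) (da1 t0).
  rewrite (_ : (fun s => _) = cst 0); last by apply/funext => s; exact: e0a.
  case=> _; rewrite derive_cst => /esym/eqP.
  rewrite addr_eq0 => /eqP ->; rewrite e0E lorentzZl -cc mulKf//.
  exact: lt0r_neq0.
have [/(_ i0 i00) + _ _] := feq t0; rewrite /covariant_derivative normal.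
move=> /rowP/(_ 0); rewrite !mxE -/(c t0) => E.
have [e1a e11] := frenet_second_vector n0 Ha (da1 t0) fe.
have h1 := hyperbolic_space_time_coord_ge1 (Ha t0).
have e1h : e 1%N t0 0 0 ^+ 2 < alpha t0 0 0 ^+ 2.
  have := tangent_sqr_time_coord (Ha t0).1 e1a; nra.
(* The coordinate 0 of the first Frenet equation. *)
have {}E : derive1 (e 0%N) t0 0 0
    = c t0 * (alpha t0 0 0 + j t0 0 i0 * e 1%N t0 0 0).
  by rewrite mulrDr -E mulVKf ?lt0r_neq0//; ring.
rewrite E pmulr_rgt0//.
have a0 := (Ha t0).2; have := j1 t0.
move: e1h; rewrite -ltr_sqrt ?exprn_gt0// !sqrtr_sqr (gtr0_norm a0) => e1h ji.
have : `|j t0 0 i0 * e 1%N t0 0 0| < alpha t0 0 0.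
  by apply: le_lt_trans e1h; rewrite normrM ler_piMl// ltW.
by rewrite ltr_norml => /andP[+ _]; rewrite -subr_gt0 opprK addrC.
Qed.

End Curves.

Theorem proposition1p3 (R : realType) (n : nat) (hn : (1 <= n)%N) :
  exists (s : R -> 'rV[R]_n) (eps0 : R),
    [/\ curvature_like s,
        0 < eps0
      & forall eps : R, 0 < eps -> eps < eps0 ->
        ~ exists (alpha : R -> 'rV[R]_n.+2) (j : R -> 'rV[R]_n),
            [/\ closed_frenet_curve alpha,
                frenet_curvatures alpha j
              & forall t : R, euclidean_norm (s t - j t) < eps]].
Proof.
have half0 : 0 < 2^-1 :> R by rewrite invr_gt0.
exists (fun=> const_mx 2^-1), 2^-1; split=> //.
  split=> [t||t i _] //; first exact: cst_continuous.
  by rewrite mxE.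
move=> eps _ eps_half [alpha [j [calpha jalpha sj]]].
have [] := @closed_curve_first_curvature_ge1 R n alpha j (Ordinal hn) erefl
  calpha jalpha.
move=> t; have := le_lt_trans (euclidean_norm_coord_le _ (Ordinal hn)) (sj t).
rewrite !mxE => /lt_trans/(_ eps_half); rewrite !ltr_norml => /andP[lo hi].
by apply/andP; split; lra.
Qed.
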